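(* For every index $\boldsymbol{k}$, \[q^{\boldsymbol{p}(\boldsymbol{p}+1)/2}\sum_{l\ge0}[\boldsymbol{p}]^l\,\zeta^\star_{\widehat{\mathcal{Q}}}(\{1\}^l,\boldsymbol{k})+\sum_{l\ge0}(q^{-\boldsymbol{p}}[\boldsymbol{p}])^l\,\overline{\zeta}^\star_{\widehat{\mathcal{Q}}}(\{1\}^l,\boldsymbol{k}^\vee)=0\] in $\widehat{\mathcal{Q}}$, where $\{1\}^l$ denotes $l$ consecutive entries equal to $1$.
   Context: Indices. An index is a finite sequence of positive integers. For an index $\boldsymbol{k}$, Hoffman's dual $\boldsymbol{k}^\vee$ is obtained by writing each component $k_i$ as a sum $1+\cdots+1$ of ones and then interchanging commas and plus signs; for example $(3,1)^\vee=(1,1,2)$. $q$-sums. Let $[n]=(1-q^n)/(1-q)$. For an index $(k_1,\dots,k_d)$ set \[H^\star_m(\boldsymbol{k};q)=\sum_{m\ge m_1\ge\cdots\ge m_d>0}\prod_a\frac{q^{(k_a-1)m_a}}{[m_a]^{k_a}},\qquad \overline{H}^\star_m(\boldsymbol{k};q)=\sum_{m\ge m_1\ge\cdots\ge m_d>0}\prod_a\frac{q^{m_a}}{[m_a]^{k_a}}.\] The ring $\widehat{\mathcal{Q}}$. For a prime $p$, $\mathbb{Z}_{(p)}$ is the set of rationals whose denominator is prime to $p$, and $Z_{p,n}=\mathbb{Z}_{(p)}[q]/([p]^n)$. Set $\mathcal{Q}_n=(\prod_pZ_{p,n})/(\bigoplus_pZ_{p,n})$ and $\widehat{\mathcal{Q}}=\varprojlim_n\mathcal{Q}_n$;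 here $[m]$ is invertible in $Z_{p,n}$ for $1\le m<p$. Define \[\zeta^\star_{\widehat{\mathcal{Q}}}(\boldsymbol{k})=((H^\star_{p-1}(\boldsymbol{k};q)\bmod[p]^n)_p)_n,\qquad \overline{\zeta}^\star_{\widehat{\mathcal{Q}}}(\boldsymbol{k})=((\overline{H}^\star_{p-1}(\boldsymbol{k};q)\bmod[p]^n)_p)_n.\] Put $[\boldsymbol{p}]=(([p]\bmod[p]^n)_p)_n$ and $q^{-\boldsymbol{p}}=(((q^p)^{-1}\bmod[p]^n)_p)_n$ (note $q^p=1-(1-q)[p]$ is invertible modulo $[p]^n$). Put $q^{\boldsymbol{p}(\boldsymbol{p}+1)/2}=((q^{p(p+1)/2}\bmod[p]^n)_p)_n$. The ring $\widehat{\mathcal{Q}}$ is complete in the $[\boldsymbol{p}]$-adic topology. *)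

(* Defs.v *)
From HB Require Import structures.
From mathcomp Require Import all_boot all_order all_algebra.
From mathcomp Require Import ring_quotient qpoly.
From mathcomp Require Import all_classical topology normedtype sequences.

Set Implicit Arguments.
Unset Strict Implicit.
Unset Printing Implicit Defensive.

Import Order.TTheory GRing.Theory Num.Theory.
Local Open Scope classical_set_scope.
Local Open Scope ring_scope.

(* Nonempty: the empty sequence has no components to dualise, and the duality
   relation fails for it. *)
Definition is_index (k : seq nat) : bool := (k != [::]) && all (leq 1) k.

(* The separators of an index: each component k_i = 1 + ... + 1 contributes
   k_i - 1 plus signs (false), and commas (true) stand between components. *)
Definition separators (k : seq nat) : seq bool :=
  behead (flatten [seq true :: nseq k_i.-1 false | k_i <- k]).

(* Inverse of separators; n is the value accumulated in the current component. *)
Fixpoint of_separators (n : nat) (s : seq bool) : seq nat :=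
  match s with
  | [::] => [:: n]
  | true :: s' => n :: of_separators 1 s'
  | false :: s' => of_separators n.+1 s'
  end.

Definition hoffman_dual (k : seq nat) : seq nat :=
  of_separators 1 (map negb (separators k)).

Example hoffman_dual_31 : hoffman_dual [:: 3; 1]%N = [:: 1; 1; 2]%N.
Proof. by []. Qed.

(* [m] = (1 - q^m) / (1 - q), written without division. *)
Definition qint (A : pzSemiRingType) (q : A) (m : nat) : A :=
  \sum_(i < m) q ^+ i.

Lemma qintE (A : pzRingType) (q : A) m : (1 - q) * qint q m = 1 - q ^+ m.
Proof. by rewrite -[1 - q]opprB mulNr -subrX1 opprB. Qed.

(* The sequences M >= m_1 >= ... >= m_d > 0. *)
Definition star_chain (d M : nat) (m : d.-tuple 'I_M.+1) : bool :=
  sorted geq [seq val i | i <- m] && all (leq 1) [seq val i | i <- m].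

Definition Hstar (A : comUnitRingType) (q : A) (M : nat) (k : seq nat) : A :=
  \sum_(m : (size k).-tuple 'I_M.+1 | star_chain m)
    \prod_(a < size k)
      (q ^+ ((nth 0 k a).-1 * tnth m a) / qint q (tnth m a) ^+ nth 0 k a).

Definition Hbarstar (A : comUnitRingType) (q : A) (M : nat) (k : seq nat) : A :=
  \sum_(m : (size k).-tuple 'I_M.+1 | star_chain m)
    \prod_(a < size k)
      (q ^+ tnth m a / qint q (tnth m a) ^+ nth 0 k a).

Section Zlocal.
Variable p : nat.

Definition Zlocal_pred : {pred rat} := [pred x | coprime p `|denq x|].

Lemma Zlocal_predP (x : rat) :
  reflect (exists2 d : nat, coprime p d & exists z : int, x * d%:R = z%:~R)
          (x \in Zlocal_pred).
Proof.
apply: (iffP idP) => [xp|[d pd [z xd]]].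
  exists `|denq x|%N; first exact: xp.
  exists (numq x); rewrite numqE -[in RHS]absz_denq; congr (_ * _).
rewrite inE /=; apply: coprime_dvdr pd.
have e : (numq x * d = z * denq x)%R.
  apply/eqP; rewrite -(eqr_int rat) !intrM -xd numqE.
  by rewrite mulrAC.
have : (denq x %| numq x * d)%Z by rewrite e dvdz_mull.
rewrite Gauss_dvdzr ?dvdzE //.
by rewrite coprimezE coprime_sym coprime_num_den.
Qed.

Fact Zlocal_subring_closed : subring_closed Zlocal_pred.
Proof.
split.
- by rewrite inE /= coprimen1.
- move=> x y /Zlocal_predP[d pd [z xd]] /Zlocal_predP[e pe [t ye]].
  apply/Zlocal_predP; exists (d * e)%N; first by rewrite coprimeMr pd.
  exists (z * e - t * d); rewrite natrM rmorphB !rmorphM /= -xd -ye.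
  by rewrite mulrBl mulrA !pmulrn; congr (_ - _); rewrite mulrCA mulrC.
- move=> x y /Zlocal_predP[d pd [z xd]] /Zlocal_predP[e pe [t ye]].
  apply/Zlocal_predP; exists (d * e)%N; first by rewrite coprimeMr pd.
  by exists (z * t); rewrite natrM rmorphM /= -xd -ye mulrACA.
Qed.
HB.instance Definition _ :=
  GRing.isSubringClosed.Build rat Zlocal_pred Zlocal_subring_closed.

Definition Zlocal := {x : rat | x \in Zlocal_pred}.
HB.instance Definition _ := SubType.on Zlocal.
HB.instance Definition _ := Choice.on Zlocal.
HB.instance Definition _ := [SubChoice_isSubComNzRing of Zlocal by <:].
End Zlocal.

(* Z_{p,n+1} = Z_(p)[q] / ([p]^(n+1)).  The level is shifted by one because
   Z_{p,0} = 0 and the null ring is not a comNzRingType; this does not affect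
   the inverse limit. *)
Section Zpn.
Variables (p n : nat).

Definition qmodulus : {poly Zlocal p} := qint 'X p ^+ n.+1.

Definition Zpn : Type := {poly %/ qmodulus}.
HB.instance Definition _ := GRing.ComNzRing.on Zpn.

Definition Zpn_unit : {pred Zpn} := [pred x | `[< exists y, y * x = 1 >]].
Definition Zpn_inv (x : Zpn) : Zpn :=
  if pselect (exists y, y * x = 1) is left h then projT1 (cid h) else x.

Fact Zpn_mulVr : {in Zpn_unit, left_inverse 1 Zpn_inv *%R}.
Proof.
move=> x /asboolP xu; rewrite /Zpn_inv; case: pselect => // h.
by case: cid.
Qed.
Fact Zpn_unitP (x y : Zpn) : y * x = 1 -> x \in Zpn_unit.
Proof. by move=> yx; apply/asboolP; exists y. Qed.
Fact Zpn_inv_out : {in [predC Zpn_unit], Zpn_inv =1 id}.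
Proof.
by move=> x /asboolPn xNu; rewrite /Zpn_inv; case: pselect => // h.
Qed.
HB.instance Definition _ :=
  GRing.ComNzRing_hasMulInverse.Build Zpn Zpn_mulVr Zpn_unitP Zpn_inv_out.

Definition qvar : Zpn := in_qpoly qmodulus 'X.

End Zpn.
Arguments qvar {p n}.

Record primeNat := PrimeNat { prime_val :> nat; prime_valP : prime prime_val }.
HB.instance Definition _ := [isSub for prime_val].
HB.instance Definition _ := [Choice of primeNat by <:].
HB.instance Definition _ := isPointed.Build primeNat (@PrimeNat 2 isT).

Section ZpnTheory.
Variable p : primeNat.

Let p_prime : prime p := prime_valP p.
Let p_gt1 : (1 < p)%N := prime_gt1 p_prime.

Lemma size_qint_poly (R : nzRingType) m : size (qint ('X : {poly R}) m) = m.
Proof.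
have -> : qint ('X : {poly R}) m = \poly_(i < m) 1.
  by rewrite poly_def; apply: eq_bigr => i _; rewrite scale1r.
by rewrite size_poly_eq ?oner_eq0.
Qed.

Lemma monic_qint_poly (R : nzRingType) m :
  (0 < m)%N -> qint ('X : {poly R}) m \is monic.
Proof.
case: m => // m _; rewrite monicE /lead_coef size_qint_poly /= /qint.
rewrite coef_sum (bigD1 ord_max) //= coefXn eqxx big1 ?addr0 // => i im.
rewrite coefXn; case: eqP => // mi; case/negP: im; apply/eqP/val_inj => /=.
exact: esym mi.
Qed.

Lemma monic_qmodulus n : qmodulus p n \is monic.
Proof. by rewrite monic_exp // monic_qint_poly // prime_gt0. Qed.

Lemma size_qmodulus n : (1 < size (qmodulus p n))%N.
Proof.
have qM : qint ('X : {poly Zlocal p}) p \is monic.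
  by rewrite monic_qint_poly // prime_gt0.
rewrite /qmodulus; elim: n => [|n IHn].
  by rewrite expr1 size_qint_poly.
rewrite exprS size_Mmonic ?size_qint_poly ?monic_neq0 ?monic_exp //.
case: (size _) IHn => // s; case: (p : nat) p_gt1 => // r rp ss.
by rewrite addSn /= ltn_addl.
Qed.

(* The ring is really the quotient by [p]^(n+1): no default value is used. *)
Lemma mk_monic_qmodulus n : mk_monic (qmodulus p n) = qmodulus p n.
Proof. by rewrite /mk_monic size_qmodulus monic_qmodulus. Qed.

Lemma in_qpoly_eq n (f g : {poly Zlocal p}) :
  in_qpoly (qmodulus p n) f = in_qpoly (qmodulus p n) g <->
  exists h, f - g = h * qmodulus p n.
Proof.
have qM := monic_qmodulus n; split=> [|[h fg]].
  move/(congr1 val); rewrite /= mk_monic_qmodulus => efg.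
  exists (Pdiv.CommonRing.rdivp f (qmodulus p n) -
          Pdiv.CommonRing.rdivp g (qmodulus p n)).
  rewrite {1}(Pdiv.RingMonic.rdivp_eq qM f) {1}(Pdiv.RingMonic.rdivp_eq qM g).
  by rewrite efg opprD addrACA subrr addr0 mulrBl.
apply/val_inj; rewrite /= mk_monic_qmodulus.
rewrite -[f](subrK g) fg Pdiv.RingMonic.rmodpD //.
by rewrite Pdiv.RingMonic.rmodp_mull // add0r.
Qed.

Lemma in_qpoly_qint n m : in_qpoly (qmodulus p n) (qint 'X m) = qint qvar m.
Proof.
rewrite /qint rmorph_sum; apply: eq_bigr => i _; rewrite rmorphXn //.
Qed.

Lemma qint_prime_expr0 n m : (n < m)%N -> qint (qvar : Zpn p n) p ^+ m = 0.
Proof.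
move=> nm; rewrite -(subnK nm) exprD -in_qpoly_qint -[X in _ * X]rmorphXn /=.
suff -> : in_qpoly (qmodulus p n) (qint 'X p ^+ n.+1) = 0 by rewrite mulr0.
rewrite -(in_qpoly0 (qmodulus p n)); apply/in_qpoly_eq.
by exists 1; rewrite subr0 mul1r.
Qed.

Lemma unit_1B_qint n (x : Zpn p n) : 1 - x * qint qvar p \is a GRing.unit.
Proof.
apply/unitrPr; exists (\sum_(i < n.+1) (x * qint qvar p) ^+ i).
rewrite -[1 - _]opprB mulNr -subrX1 exprMn qint_prime_expr0 // mulr0.
by rewrite sub0r opprK.
Qed.

Lemma unit_qvar_exp_prime n : (qvar : Zpn p n) ^+ p \is a GRing.unit.
Proof.
by rewrite -[_ ^+ p](subKr 1) -qintE unit_1B_qint.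
Qed.

Lemma qintM (A : comNzRingType) (q : A) a b :
  qint q (a * b) = qint q a * qint (q ^+ a) b.
Proof.
elim: b => [|b IHb]; first by rewrite muln0 /qint !big_ord0 mulr0.
rewrite mulnS addnC /qint big_split_ord /= -/(qint q (a * b)) IHb.
rewrite big_ord_recr /= mulrDr; congr (_ + _).
rewrite mulr_suml; apply: eq_bigr => i _.
by rewrite -exprM -exprD addnC.
Qed.

Lemma unit_qint n m : (0 < m < p)%N -> qint (qvar : Zpn p n) m \is a GRing.unit.
Proof.
case/andP=> m0 mp.
have /(coprimeP _ m0)[[u v] /= uv] : coprime m p.
  by rewrite coprime_sym prime_coprime // gtnNdvd.
have e : (u * m = (v * p).+1)%N.
  by rewrite -add1n -uv subnK // ltnW // -subn_gt0 uv.
suff : qint (qvar : Zpn p n) m * qint (qvar ^+ m) u \is a GRing.unit.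
  by rewrite unitrM => /andP[].
rewrite -qintM mulnC e /qint big_ord_recl expr0.
under eq_bigr do rewrite /= /bump /= add1n exprS.
rewrite -mulr_sumr -/(qint _ _) (mulnC v) qintM.
rewrite [qint _ p * _]mulrC mulrA -[_ * qint _ p]opprK -mulNr.
exact: unit_1B_qint.
Qed.

Definition Zpn_red n (x : Zpn p n.+1) : Zpn p n :=
  in_qpoly (qmodulus p n) (val x).

Lemma Zpn_redE n (f : {poly Zlocal p}) :
  Zpn_red (in_qpoly (qmodulus p n.+1) f) = in_qpoly (qmodulus p n) f.
Proof.
apply/in_qpoly_eq; rewrite /= mk_monic_qmodulus.
exists (- (Pdiv.CommonRing.rdivp f (qmodulus p n.+1) * qint 'X p)).
rewrite {2}(Pdiv.RingMonic.rdivp_eq (monic_qmodulus n.+1) f).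
by rewrite opprD addrCA subrr addr0 mulNr -mulrA -exprS.
Qed.

Lemma in_qpoly_val n (x : Zpn p n) : in_qpoly (qmodulus p n) (val x) = x.
Proof. by apply/val_inj; exact: (in_qpoly_small (size_mk_monic x)). Qed.

Fact Zpn_red_is_zmod_morphism n : zmod_morphism (@Zpn_red n).
Proof. by move=> x y; exact: (raddfB (in_qpoly (qmodulus p n))). Qed.
Fact Zpn_red_is_monoid_morphism n : monoid_morphism (@Zpn_red n).
Proof.
split=> [|x y].
  by rewrite -[1](in_qpoly1 (qmodulus p n.+1)) Zpn_redE rmorph1.
rewrite -[x in LHS]in_qpoly_val -[y in LHS]in_qpoly_val -in_qpolyM Zpn_redE.
by rewrite in_qpolyM.
Qed.
HB.instance Definition _ n := GRing.isZmodMorphism.Build (Zpn p n.+1) (Zpn p n)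
  (@Zpn_red n) (@Zpn_red_is_zmod_morphism n).
HB.instance Definition _ n := GRing.isMonoidMorphism.Build (Zpn p n.+1) (Zpn p n)
  (@Zpn_red n) (@Zpn_red_is_monoid_morphism n).

Lemma Zpn_red_qvar n : Zpn_red (qvar : Zpn p n.+1) = qvar.
Proof. exact: Zpn_redE. Qed.

Lemma Zpn_red_qint n m : Zpn_red (qint (qvar : Zpn p n.+1) m) = qint qvar m.
Proof. by rewrite -in_qpoly_qint Zpn_redE in_qpoly_qint. Qed.
End ZpnTheory.

(* Product of a nonempty family of commutative rings. *)
Section DProd.
Variables (I : pointedType) (R : I -> comNzRingType).

Definition dprod : Type := forall i, R i.
HB.instance Definition _ := Choice.on dprod.

Let add (f g : dprod) : dprod := fun i => f i + g i.
Let opp (f : dprod) : dprod := fun i => - f i.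
Let mul (f g : dprod) : dprod := fun i => f i * g i.

Lemma dprodP (f g : dprod) : (forall i, f i = g i) -> f = g.
Proof. exact: functional_extensionality_dep. Qed.

Fact dprod_addA : associative add.
Proof. by move=> f g h; apply/dprodP => i; exact: addrA. Qed.
Fact dprod_addC : commutative add.
Proof. by move=> f g; apply/dprodP => i; exact: addrC. Qed.
Fact dprod_add0 : left_id (fun i => 0) add.
Proof. by move=> f; apply/dprodP => i; exact: add0r. Qed.
Fact dprod_addN : left_inverse (fun i => 0) opp add.
Proof. by move=> f; apply/dprodP => i; exact: addNr. Qed.
HB.instance Definition _ :=
  GRing.isZmodule.Build dprod dprod_addA dprod_addC dprod_add0 dprod_addN.

Fact dprod_mulA : associative mul.
Proof. by move=> f g h; apply/dprodP => i; exact: mulrA. Qed.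
Fact dprod_mulC : commutative mul.
Proof. by move=> f g; apply/dprodP => i; exact: mulrC. Qed.
Fact dprod_mul1 : left_id (fun i => 1) mul.
Proof. by move=> f; apply/dprodP => i; exact: mul1r. Qed.
Fact dprod_mulDl : left_distributive mul add.
Proof. by move=> f g h; apply/dprodP => i; exact: mulrDl. Qed.
Fact dprod_1neq0 : (fun i => 1 : R i) != 0 :> dprod.
Proof. by apply/eqP => /(congr1 (fun f => f point)) /eqP; rewrite oner_eq0. Qed.
HB.instance Definition _ := GRing.Zmodule_isComNzRing.Build dprod
  dprod_mulA dprod_mulC dprod_mul1 dprod_mulDl dprod_1neq0.

Lemma dprodD (f g : dprod) i : (f + g) i = f i + g i. Proof. by []. Qed.
Lemma dprodN (f : dprod) i : (- f) i = - f i. Proof. by []. Qed.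
Lemma dprodB (f g : dprod) i : (f - g) i = f i - g i. Proof. by []. Qed.
Lemma dprodM (f g : dprod) i : (f * g) i = f i * g i. Proof. by []. Qed.
Lemma dprod0 i : (0 : dprod) i = 0. Proof. by []. Qed.
Lemma dprod1 i : (1 : dprod) i = 1. Proof. by []. Qed.
End DProd.

Lemma infinite_primeNat : ~ finite_set [set: primeNat].
Proof.
move=> /(finite_image prime_val)/finite_seqP[s es].
have [p ps pp] := prime_above (\max_(i <- s) i).
have : p \in s by have : [set` s] p by rewrite -es; exists (PrimeNat pp).
by move=> /(@leq_bigmax_seq _ s xpredT (fun i => i)) /(_ isT); rewrite leqNgt ps.
Qed.

Section Qn.
Variable n : nat.

Definition Zprod : Type := dprod (fun p : primeNat => Zpn p n).
HB.instance Definition _ := GRing.ComNzRing.on Zprod.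

(* The direct sum over p, as an ideal of the product. *)
Definition Zsum : {pred Zprod} :=
  [pred f | `[< finite_set [set p | f p != 0] >]].

Fact Zsum_idealr : idealr_closed Zsum.
Proof.
split.
- by apply/asboolP; apply: sub_finite_set (@finite_set0 _) => p /=; rewrite eqxx.
- apply/negP => /asboolP; apply: contra_not infinite_primeNat.
  by apply: sub_finite_set => p _ /=; rewrite oner_eq0.
- move=> a f g /asboolP ff /asboolP fg; apply/asboolP.
  have : finite_set ([set p | f p != 0] `|` [set p | g p != 0]).
    by rewrite finite_setU.
  apply: sub_finite_set => p /=; rewrite dprodD dprodM => fgp.
  case: (eqVneq (f p) 0) fgp => [->|fp _]; last by left.
  by rewrite mulr0 add0r; right.
Qed.
HB.instance Definition _ := isIdealr.Build Zprod Zsum Zsum_idealr.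

Definition Qn : Type := {ideal_quot Zsum}.
HB.instance Definition _ := GRing.ComNzRing.on Qn.
HB.instance Definition _ := EqQuotient.on Qn.
Definition Qn_pi (f : Zprod) : Qn := \pi_({ideal_quot Zsum})%qT f.

Fact Qn_pi_is_zmod_morphism : zmod_morphism Qn_pi.
Proof. exact: (raddfB \pi_({ideal_quot Zsum})%qT). Qed.
Fact Qn_pi_is_monoid_morphism : monoid_morphism Qn_pi.
Proof.
exact: (conj (rmorph1 \pi_({ideal_quot Zsum})%qT)
             (rmorphM \pi_({ideal_quot Zsum})%qT)).
Qed.
HB.instance Definition _ :=
  GRing.isZmodMorphism.Build Zprod Qn Qn_pi Qn_pi_is_zmod_morphism.
HB.instance Definition _ :=
  GRing.isMonoidMorphism.Build Zprod Qn Qn_pi Qn_pi_is_monoid_morphism.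

Lemma Qn_pi_eq (f g : Zprod) :
  Qn_pi f = Qn_pi g <-> finite_set [set p | f p != g p].
Proof.
have -> : [set p | f p != g p] = [set p | (f - g) p != 0].
  by apply/seteqP; split=> p /=; rewrite dprodB subr_eq0.
rewrite /Qn_pi; split=> [/eqP|fg].
  by rewrite -Quotient.idealrBE => /asboolP.
by apply/eqP; rewrite -Quotient.idealrBE; apply/asboolP.
Qed.

Definition Qn_repr (x : Qn) : Zprod := repr (x : {ideal_quot Zsum}).

Lemma Qn_reprK : cancel Qn_repr Qn_pi.
Proof. by move=> x; exact: reprK. Qed.
End Qn.

Definition Zprod_red n (f : Zprod n.+1) : Zprod n := fun p => Zpn_red (f p).

Definition Qn_red n (x : Qn n.+1) : Qn n := Qn_pi (Zprod_red (Qn_repr x)).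

Lemma Qn_redE n (f : Zprod n.+1) : Qn_red (Qn_pi f) = Qn_pi (Zprod_red f).
Proof.
apply/Qn_pi_eq; have /Qn_pi_eq := Qn_reprK (Qn_pi f).
by apply: sub_finite_set => p /=; apply: contraNN => /eqP; rewrite /Zprod_red => ->.
Qed.

Fact Qn_red_is_zmod_morphism n : zmod_morphism (@Qn_red n).
Proof.
move=> x y; rewrite -(Qn_reprK x) -(Qn_reprK y) -raddfB !Qn_redE -raddfB.
by congr Qn_pi; apply: functional_extensionality_dep => p; exact: raddfB.
Qed.
Fact Qn_red_is_monoid_morphism n : monoid_morphism (@Qn_red n).
Proof.
split=> [|x y].
  rewrite -(rmorph1 (@Qn_pi n.+1)) Qn_redE -(rmorph1 (@Qn_pi n)).
  by congr Qn_pi; apply: functional_extensionality_dep => p; exact: rmorph1.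
rewrite -(Qn_reprK x) -(Qn_reprK y) -rmorphM !Qn_redE -rmorphM.
by congr Qn_pi; apply: functional_extensionality_dep => p; exact: rmorphM.
Qed.
HB.instance Definition _ n := GRing.isZmodMorphism.Build (Qn n.+1) (Qn n)
  (@Qn_red n) (@Qn_red_is_zmod_morphism n).
HB.instance Definition _ n := GRing.isMonoidMorphism.Build (Qn n.+1) (Qn n)
  (@Qn_red n) (@Qn_red_is_monoid_morphism n).

Definition Qprod : Type := dprod (fun n : nat => Qn n).
HB.instance Definition _ := GRing.ComNzRing.on Qprod.

Definition Qhat_pred : {pred Qprod} :=
  [pred x | `[< forall n : nat, @Qn_red n (x n.+1) = x n >]].

Fact Qhat_subring_closed : subring_closed Qhat_pred.
Proof.
split.
- by apply/asboolP => n; exact: rmorph1.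
- move=> x y /asboolP xP /asboolP yP; apply/asboolP => n.
  by rewrite !dprodB raddfB /= xP yP.
- move=> x y /asboolP xP /asboolP yP; apply/asboolP => n.
  by rewrite !dprodM rmorphM /= xP yP.
Qed.
HB.instance Definition _ :=
  GRing.isSubringClosed.Build Qprod Qhat_pred Qhat_subring_closed.

Definition Qhat := {x : Qprod | x \in Qhat_pred}.
HB.instance Definition _ := SubType.on Qhat.
HB.instance Definition _ := Choice.on Qhat.
HB.instance Definition _ := [SubChoice_isSubComNzRing of Qhat by <:].
HB.instance Definition _ := isPointed.Build Qhat 0.

Definition Qhat_proj n (x : Qhat) : Qn n := (val x : Qprod) n.
Fact Qhat_proj_is_zmod_morphism n : zmod_morphism (@Qhat_proj n).
Proof. by move=> x y. Qed.
Fact Qhat_proj_is_monoid_morphism n : monoid_morphism (@Qhat_proj n).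
Proof. by []. Qed.
HB.instance Definition _ n := GRing.isZmodMorphism.Build Qhat (Qn n)
  (@Qhat_proj n) (@Qhat_proj_is_zmod_morphism n).
HB.instance Definition _ n := GRing.isMonoidMorphism.Build Qhat (Qn n)
  (@Qhat_proj n) (@Qhat_proj_is_monoid_morphism n).

Lemma Qhat_eq (x y : Qhat) : (forall n, Qhat_proj n x = Qhat_proj n y) -> x = y.
Proof.
by move=> xy; apply: val_inj; apply: functional_extensionality_dep.
Qed.

Lemma Qn_red_proj n (x : Qhat) : Qn_red (Qhat_proj n.+1 x) = Qhat_proj n x.
Proof. by have /asboolP := valP x; apply. Qed.

(* ((f_{n,p} mod [p]^n)_p)_n, for a family f compatible with the reductions. *)
Fact Qhat_of_subproof (f : forall n, Zprod n) :
  (forall n p, Zpn_red (f n.+1 p) = f n p) ->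
  (fun n => Qn_pi (f n)) \in Qhat_pred.
Proof.
move=> fP; apply/asboolP => n; rewrite Qn_redE; congr Qn_pi.
by apply: functional_extensionality_dep => p; exact: fP.
Qed.
Definition Qhat_of (f : forall n, Zprod n)
    (fP : forall n p, Zpn_red (f n.+1 p) = f n p) : Qhat :=
  exist (fun x : Qprod => x \in Qhat_pred) _ (Qhat_of_subproof fP).

Section CompatibleFamilies.
Variables (p : primeNat) (n : nat).

Lemma Zpn_red_Hstar (k : seq nat) :
  Zpn_red (Hstar (qvar : Zpn p n.+1) p.-1 k) = Hstar qvar p.-1 k.
Proof.
rewrite /Hstar rmorph_sum; apply: eq_bigr => m /andP[_ /allP m0].
rewrite rmorph_prod; apply: eq_bigr => a _.
rewrite rmorphM rmorphXn /= Zpn_red_qvar rmorphV ?unitrX ?unit_qint //.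
  by rewrite rmorphXn /= Zpn_red_qint.
rewrite m0 /=; last by rewrite map_f // mem_tnth.
by rewrite (leq_trans (ltn_ord _)) // prednK // prime_gt0 // prime_valP.
Qed.

Lemma Zpn_red_Hbarstar (k : seq nat) :
  Zpn_red (Hbarstar (qvar : Zpn p n.+1) p.-1 k) = Hbarstar qvar p.-1 k.
Proof.
rewrite /Hbarstar rmorph_sum; apply: eq_bigr => m /andP[_ /allP m0].
rewrite rmorph_prod; apply: eq_bigr => a _.
rewrite rmorphM rmorphXn /= Zpn_red_qvar rmorphV ?unitrX ?unit_qint //.
  by rewrite rmorphXn /= Zpn_red_qint.
rewrite m0 /=; last by rewrite map_f // mem_tnth.
by rewrite (leq_trans (ltn_ord _)) // prednK // prime_gt0 // prime_valP.
Qed.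

Lemma Zpn_red_qvarX m : Zpn_red ((qvar : Zpn p n.+1) ^+ m) = qvar ^+ m.
Proof. by rewrite rmorphXn /= Zpn_red_qvar. Qed.

Lemma Zpn_red_qvarV : Zpn_red ((qvar : Zpn p n.+1) ^+ p)^-1 = (qvar ^+ p)^-1.
Proof. by rewrite rmorphV ?unit_qvar_exp_prime //= Zpn_red_qvarX. Qed.
End CompatibleFamilies.

Definition zeta_star (k : seq nat) : Qhat :=
  @Qhat_of (fun n p => Hstar (qvar : Zpn p n) p.-1 k)
           (fun n p => Zpn_red_Hstar p n k).

Definition zeta_barstar (k : seq nat) : Qhat :=
  @Qhat_of (fun n p => Hbarstar (qvar : Zpn p n) p.-1 k)
           (fun n p => Zpn_red_Hbarstar p n k).

Definition bold_p : Qhat :=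
  @Qhat_of (fun n p => qint (qvar : Zpn p n) p)
           (fun n p => Zpn_red_qint p n p).

Definition q_opp_p : Qhat :=
  @Qhat_of (fun n p => ((qvar : Zpn p n) ^+ p)^-1)
           (fun n p => Zpn_red_qvarV p n).

Definition q_triangle_p : Qhat :=
  @Qhat_of (fun n p => (qvar : Zpn p n) ^+ (p * p.+1)./2)
           (fun n p => Zpn_red_qvarX p n (p * p.+1)./2).

(* The [p]-adic topology: the sets x + [p]^N Qhat form a basis of
   neighbourhoods of x. *)
Definition adic_ball (x : Qhat) (N : nat) : set Qhat :=
  [set y | exists z, y - x = bold_p ^+ N * z].

HB.instance Definition _ :=
  hasNbhs.Build Qhat (fun x => filter_from setT (adic_ball x)).

Lemma adic_ball_refl x N : adic_ball x N x.
Proof. by exists 0; rewrite subrr mulr0. Qed.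

Lemma adic_ball_trans x y z N :
  adic_ball x N y -> adic_ball y N z -> adic_ball x N z.
Proof.
move=> [u yx] [v zy]; exists (u + v).
by rewrite mulrDr -yx -zy [RHS]addrC addrA subrK.
Qed.

Lemma adic_ball_sym x y N : adic_ball x N y -> adic_ball y N x.
Proof. by move=> [u yx]; exists (- u); rewrite mulrN -yx opprB. Qed.

Lemma adic_ball_le x M N : (M <= N)%N -> adic_ball x N `<=` adic_ball x M.
Proof.
move=> MN y [z yx]; exists (bold_p ^+ (N - M) * z).
by rewrite mulrA -exprD subnKC.
Qed.

Fact Qhat_nbhs_filter (x : Qhat) : ProperFilter (nbhs x).
Proof.
apply: filter_from_proper; last by move=> N _; exists x; exact: adic_ball_refl.
apply: filter_from_filter; first by exists 0%N.
move=> M N _ _; exists (maxn M N) => // y xy.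
by split; apply: adic_ball_le xy; rewrite ?leq_maxl ?leq_maxr.
Qed.
Fact Qhat_nbhs_singleton (x : Qhat) (A : set Qhat) : nbhs x A -> A x.
Proof. by move=> [N _]; apply; exact: adic_ball_refl. Qed.
Fact Qhat_nbhs_nbhs (x : Qhat) (A : set Qhat) : nbhs x A -> nbhs x (nbhs^~ A).
Proof.
move=> [N _ xA]; exists N => // y xy; exists N => // z yz.
by apply: xA; exact: adic_ball_trans yz.
Qed.
HB.instance Definition _ := Nbhs_isNbhsTopological.Build Qhat
  Qhat_nbhs_filter Qhat_nbhs_singleton Qhat_nbhs_nbhs.


Lemma proj_bold_p_expn n m : (n < m)%N -> Qhat_proj n (bold_p ^+ m) = 0.
Proof.
move=> nm; rewrite rmorphXn /=.
have -> : Qhat_proj n bold_p = Qn_pi (fun p => qint qvar p : Zpn p n) by [].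
rewrite -(rmorphXn (@Qn_pi n)) -(rmorph0 (@Qn_pi n)); congr Qn_pi.
apply: functional_extensionality_dep => p.
have -> : forall (f : Zprod n) l, (f ^+ l) p = f p ^+ l.
  by move=> f; elim=> [|l IHl]; rewrite ?expr0 // !exprS dprodM IHl.
exact: qint_prime_expr0.
Qed.

Lemma Qhat_hausdorff : hausdorff_space Qhat.
Proof.
move=> x y xy; apply: Qhat_eq => n.
have [z [xz yz]] : adic_ball x n.+1 `&` adic_ball y n.+1 !=set0.
  by apply: xy; exists n.+1.
have [u xyu] : adic_ball y n.+1 x.
  exact: adic_ball_trans yz (adic_ball_sym xz).
apply/eqP; rewrite -subr_eq0 -rmorphB xyu rmorphM /=.
by rewrite proj_bold_p_expn // mul0r.
Qed.

Section AdicSum.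

Let psum (u : nat -> Qhat) N : Qhat := \sum_(l < N) bold_p ^+ l * u l.

Let proj_psum u n N :
  (n < N)%N -> Qhat_proj n (psum u N) = Qhat_proj n (psum u n.+1).
Proof.
move=> nN; rewrite -(subnKC nN) /psum big_split_ord /= rmorphD /=.
rewrite [X in _ + X](_ : _ = 0) ?addr0 // rmorph_sum big1 // => i _.
by rewrite rmorphM /= proj_bold_p_expn ?mul0r // leq_addr.
Qed.

Fact adic_sum_subproof (u : nat -> Qhat) :
  (fun n => Qhat_proj n (psum u n.+1)) \in Qhat_pred.
Proof.
by apply/asboolP => n; rewrite Qn_red_proj proj_psum.
Qed.
Definition adic_sum (u : nat -> Qhat) : Qhat :=
  exist (fun x : Qprod => x \in Qhat_pred) _ (adic_sum_subproof u).

Lemma adic_sum_split (u : nat -> Qhat) N :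
  adic_sum u =
  \sum_(l < N) bold_p ^+ l * u l +
  bold_p ^+ N * adic_sum (fun l => u (N + l)%N).
Proof.
have adicE v n : Qhat_proj n (adic_sum v) = Qhat_proj n (psum v n.+1) by [].
apply: Qhat_eq => n; rewrite adicE rmorphD rmorphM /= adicE -rmorphM -rmorphD.
rewrite -(@proj_psum _ _ (N + n.+1)) ?leq_addl //; congr Qhat_proj.
rewrite /psum big_split_ord /=; congr (_ + _).
by rewrite mulr_sumr; apply: eq_bigr => i _; rewrite exprD mulrA.
Qed.
End AdicSum.

Lemma cvg_adic_sum (u : nat -> Qhat) :
  series (fun l => bold_p ^+ l * u l) @ \oo --> adic_sum u.
Proof.
move=> A [N _ NA]; exists N => // M /= NM; apply: NA.
apply/adic_ball_sym; apply: adic_ball_le NM _ _.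
exists (adic_sum (fun l => u (M + l)%N)).
by rewrite {1}(adic_sum_split u M) seriesEord /= addrAC subrr add0r.
Qed.

(* Together with Qhat_hausdorff: limn denotes the sum of such a series. *)
Lemma is_cvg_adic_series (a : Qhat) (u : nat -> Qhat) :
  cvgn (series (fun l => (a * bold_p) ^+ l * u l)).
Proof.
apply: (cvgP (adic_sum (fun l => a ^+ l * u l))).
rewrite (_ : (fun l => (a * bold_p) ^+ l * u l) =
             (fun l => bold_p ^+ l * (a ^+ l * u l))); first exact: cvg_adic_sum.
by apply/funext => l; rewrite [a * _]mulrC exprMn mulrA.
Qed.

(* Main.v *)
(* Write f(m), g(m) for the parts of the star sums of k and of its dual in which
   the largest summation variable is m.  Prepending {1}^l and summing over
   l multiplies the m-th part by the product of (1 - [p]/[j])^-1 over m <= j < p.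
   As [j] - [p] = - q^j [p - j], this product is, up to sign and a power of q, the
   q-binomial coefficient (p-1 choose m-1); the same happens for the dual sum.
   The duality of star sums says that g(m) is a q-binomial transform T of f(m) for
   m < p: the two ways of lengthening an index are intertwined by T.  Since
   T has an explicit inverse, the two weighted sums over m < p cancel, and no
   division by [p] ever occurs.  The signs require p to be odd; p = 2 is irrelevant
   modulo the direct sum. *)
Require Import Defs.
From mathcomp Require Import all_boot all_order all_algebra.
From mathcomp Require Import all_classical topology normedtype sequences.
From mathcomp Require Import ring.

Set Implicit Arguments.
Unset Strict Implicit.
Unset Printing Implicit Defensive.

Import GRing.Theory.
Local Open Scope classical_set_scope.
Local Open Scope ring_scope.

(** * q-integers and Gaussian binomial coefficients *)

Lemma qint0 (A : pzSemiRingType) (q : A) : qint q 0 = 0.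
Proof. by rewrite /qint big_ord0. Qed.

Lemma qint1 (A : pzSemiRingType) (q : A) : qint q 1 = 1.
Proof. by rewrite /qint big_ord1. Qed.

Lemma qintD (A : pzSemiRingType) (q : A) a b :
  qint q (a + b) = qint q a + q ^+ a * qint q b.
Proof.
rewrite /qint big_split_ord /= mulr_sumr; congr (_ + _).
by apply: eq_bigr => i _; rewrite exprD.
Qed.

(** The Gaussian binomial coefficient, given by a Pascal rule so that it exists without inverting
    any q-integer. *)
Fixpoint qbin {A : pzSemiRingType} (q : A) (n m : nat) : A :=
  match n, m with
  | _, 0 => 1
  | 0, _.+1 => 0
  | n'.+1, m'.+1 => qbin q n' m' + q ^+ m * qbin q n' m
  end.

Section QBinomial.
Context {A : comNzRingType}.
Variable q : A.

Lemma qbinn0 n : qbin q n 0 = 1. Proof. by case: n. Qed.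

Lemma qbinS n m :
  qbin q n.+1 m.+1 = qbin q n m + q ^+ m.+1 * qbin q n m.+1.
Proof. by []. Qed.

Lemma qbin_small n m : (n < m)%N -> qbin q n m = 0.
Proof.
elim: n m => [|n IH] [|m] // nm.
by rewrite qbinS !IH ?mulr0 ?addr0 // ltnW.
Qed.

Lemma qbinn n : qbin q n n = 1.
Proof. by elim: n => // n IH; rewrite qbinS IH qbin_small ?mulr0 ?addr0. Qed.

Lemma qint_qbin_right n m :
  qint q m.+1 * qbin q n m.+1 = qint q (n - m) * qbin q n m.
Proof.
elim: n m => [|n IH] m; first by rewrite sub0n qint0 mul0r mulr0.
rewrite qbinS mulrDr mulrCA IH; case: m => [|m].
  by rewrite !subn0 !qbinn0 -[in RHS](add1n n) qintD qint1 expr1 !mulr1.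
rewrite qbinS subSS [RHS]mulrDr -(IH m) [X in _ = _ + X]mulrCA.
rewrite !mulrA -!mulrDl; case: (ltnP m n) => mn; last first.
  by rewrite [qbin q n m.+1]qbin_small ?mulr0.
congr (_ * _); rewrite -!qintD; congr (qint q _).
by rewrite addSn subnKC // addSn subnKC // ltnW.
Qed.

Lemma qint_qbinS n m :
  qint q m.+1 * qbin q n.+1 m.+1 = qint q n.+1 * qbin q n m.
Proof.
rewrite qbinS mulrDr mulrCA qint_qbin_right mulrA -mulrDl.
case: (leqP m n) => mn; last by rewrite qbin_small ?mulr0.
by rewrite -qintD addSn subnKC.
Qed.

(** The two Pascal rules differ by [1 - q] times the identity [qint_qbin_right], so nothing has to
    be cancelled. *)
Lemma qbinS_left n m :
  qbin q n.+1 m.+1 = q ^+ (n - m) * qbin q n m + qbin q n m.+1.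
Proof.
rewrite qbinS; have := qint_qbin_right n m => /(congr1 (fun x => (1 - q) * x)).
rewrite !mulrA !qintE => e.
have -> : q ^+ (n - m) * qbin q n m =
    qbin q n m - (1 - q ^+ m.+1) * qbin q n m.+1.
  by rewrite e mulrBl mul1r opprB addrCA subrr addr0.
by rewrite mulrBl mul1r opprB -addrA subrK.
Qed.

(* With [c r = (-1)^r q^(r choose 2)] and [O N m] the sum below, the two Pascal
   expansions give [O N.+1 m = O N m.-1 + (q^m - q^N) O N m]. *)
Lemma qbin_orthogonal N m :
  \sum_(n < N.+1) (-1) ^+ (N - n) * q ^+ 'C(N - n, 2) * (qbin q N n * qbin q n m)
  = (N == m)%:R.
Proof.
elim: N m => [|N IH] m.
  by rewrite big_ord1 /= !expr0 !mul1r; case: m.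
pose c r := (-1) ^+ r * q ^+ 'C(r, 2) : A.
have cS r : c r.+1 = - (q ^+ r * c r).
  by rewrite /c binS bin1 exprD exprS; ring.
have cD n : (n <= N)%N -> q ^+ n * c (N.+1 - n)%N = - (q ^+ N * c (N - n)%N).
  by move=> nN; rewrite subSn // cS mulrN mulrA -exprD subnKC.
rewrite big_ord_recl -/(c _) qbinn0 subn0 cS mul1r.
rewrite (eq_bigr (fun i : 'I_N.+1 => c (N - i)%N * (qbin q N i * qbin q i.+1 m)
    + c (N - i)%N * (q ^+ i.+1 * qbin q N i.+1 * qbin q i.+1 m))); last first.
  by move=> i _; rewrite lift0 subSS qbinS mulrDl mulrDr.
rewrite big_split addrCA /=.
(* By [cD], the second half of the Pascal expansion and the split-off term [n = 0] together make
   [- q^N O N m]. *)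
have -> : - (q ^+ N * c N) * qbin q 0 m +
   \sum_(i < N.+1) c (N - i)%N * (q ^+ i.+1 * qbin q N i.+1 * qbin q i.+1 m) =
   - q ^+ N * (N == m)%:R.
  rewrite -IH mulr_sumr [RHS]big_ord_recl big_ord_recr.
  rewrite [qbin q N N.+1]qbin_small // mulr0 mul0r mulr0 [X in _ + X]addr0.
  rewrite qbinn0 subn0 -/(c _); congr (_ + _); first by rewrite mul1r -mulNr -mulrA.
  apply: eq_bigr => i _; rewrite lift0 -/(c _).
  have := cD i.+1 (ltn_ord i); rewrite subSS => e.
  by rewrite -mulrA mulrCA mulrA e; ring.
pose t j i : A := c (N - i)%N * (qbin q N i * qbin q i j).
case: m => [|m].
  rewrite (eq_bigr (fun i : 'I_N.+1 => t 0 i)) => [|i _]; last by rewrite /t !qbinn0.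
  by rewrite IH; case: eqP => [->|_] /=; rewrite ?expr0; ring.
rewrite (eq_bigr (fun i : 'I_N.+1 => t m i + q ^+ m.+1 * t m.+1 i)); last first.
  by move=> i _; rewrite /t /= exprS; ring.
rewrite big_split -mulr_sumr /= !IH eqSS.
by case: (N =P m.+1) => [->|_] /=; ring.
Qed.

End QBinomial.

(** * The signed q-binomial transform *)

Section BinomialTransform.
Context {A : comNzRingType}.
Variable q : A.

Definition btrans_coef i j : A := (-1) ^+ j * q ^+ 'C(j.+1, 2) * qbin q i j.

(* The sequence [a] on 1, 2, ... is indexed from 0: [a i] is its term of index
   [i.+1]. *)
Definition btrans (a : nat -> A) i : A :=
  q ^+ i.+1 * \sum_(j < i.+1) btrans_coef i j * a j.

Lemma btrans_coefS i j :
  (-1) ^+ j * q ^+ 'C(j.+1, 2) * qbin q i.+1 j.+1 =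
  btrans_coef i j - btrans_coef i j.+1.
Proof.
by rewrite /btrans_coef qbinS (binS j.+1) bin1 !exprD !exprS; ring.
Qed.

Lemma btrans_delta i : btrans (fun j => (j == 0)%:R) i = q ^+ i.+1.
Proof.
rewrite /btrans big_ord_recl big1 => [|j _]; last by rewrite mulr0.
by rewrite /btrans_coef qbinn0 bin_small ?expr0 ?mulr1 ?addr0 ?mulr1.
Qed.

Lemma sum_by_parts (c a : nat -> A) M :
  \sum_(j < M) (c j - c j.+1) * \sum_(l < j.+1) a l =
  \sum_(j < M) c j * a j - c M * \sum_(l < M) a l.
Proof.
elim: M => [|M IH]; first by rewrite !big_ord0 mulr0 subr0.
by rewrite !big_ord_recr /= IH; ring.
Qed.

(** Absorption turns [[i+1] qbin i j] into [[j+1] qbin (i+1) (j+1)]. By [btrans_coefS] the new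
    coefficients are differences, so summation by parts undoes the partial sums of [a]; the boundary
    term contains [qbin i (i+1) = 0]. *)
Lemma btrans_average (a h : nat -> A) i :
  (forall j, (j <= i)%N -> qint q j.+1 * h j = \sum_(l < j.+1) a l) ->
  qint q i.+1 * btrans h i = btrans a i.
Proof.
move=> ha; rewrite /btrans mulrCA; congr (_ * _).
transitivity (\sum_(j < i.+1)
    (btrans_coef i j - btrans_coef i j.+1) * \sum_(l < j.+1) a l).
  rewrite mulr_sumr; apply: eq_bigr => j _.
  rewrite -btrans_coefS -ha -1?ltnS // /btrans_coef.
  transitivity ((-1) ^+ j * q ^+ 'C(j.+1, 2) * (qint q i.+1 * qbin q i j) * h j).
    by ring.
  by rewrite -qint_qbinS; ring.
rewrite sum_by_parts {2}/btrans_coef [qbin q i i.+1]qbin_small //.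
by rewrite mulr0 mul0r subr0.
Qed.

(** Counterpart of [btrans_average], with averaging now on the transformed side. By induction on
    [i]: absorption and the second Pascal rule show that passing from row [i] to row [i+1] adds
    exactly the term [btrans a (i+1)]. *)
Lemma btrans_mul (a h : nat -> A) i :
  (forall j, (j <= i)%N -> qint q j.+1 * h j = q ^+ j.+1 * a j) ->
  qint q i.+1 * btrans h i = q ^+ i.+1 * \sum_(j < i.+1) btrans a j.
Proof.
move=> ha; rewrite /btrans mulrCA; congr (_ * _).
elim: i ha => [|i IH] ha.
  rewrite qint1 mul1r !big_ord1 mulrCA; congr (_ * _).
  by rewrite -ha // qint1 mul1r.
rewrite [RHS]big_ord_recr /= -IH => [|j ji]; last exact/ha/leqW.
(* Row [i] is padded with its vanishing term [j = i+1], to be compared termwise with row [i+1]. *)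
have -> : \sum_(j < i.+1) btrans_coef i j * h j =
          \sum_(j < i.+2) btrans_coef i j * h j.
  rewrite [RHS]big_ord_recr /= {3}/btrans_coef qbin_small //.
  by rewrite mulr0 mul0r addr0.
rewrite !mulr_sumr -big_split /=; apply: eq_bigr => j _.
have ji : (j <= i.+1)%N by rewrite -ltnS.
have e : qint q i.+2 * qbin q i.+1 j =
    qint q i.+1 * qbin q i j + q ^+ (i.+1 - j) * qbin q i.+1 j * qint q j.+1.
  by rewrite -!qint_qbinS qbinS_left; ring.
have e2 : q ^+ i.+2 = q ^+ (i.+1 - j) * q ^+ j.+1.
  by rewrite -exprD addnS subnK.
rewrite e2 /btrans_coef; have {}ha := ha j ji.
transitivity ((-1) ^+ j * q ^+ 'C(j.+1, 2) *
  (qint q i.+2 * qbin q i.+1 j) * h j); first by ring.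
rewrite e mulrDr mulrDl; congr (_ + _); first by ring.
transitivity ((-1) ^+ j * q ^+ 'C(j.+1, 2) * q ^+ (i.+1 - j) * qbin q i.+1 j *
   (qint q j.+1 * h j)); first by ring.
by rewrite ha; ring.
Qed.

End BinomialTransform.

(** * Star sums as iterated sums with a general weight *)

Section StarSums.
Context {A : comNzRingType}.
Variable w : nat -> nat -> A.

Fixpoint star_sum (M : nat) (k : seq nat) : A :=
  if k is x :: k' then \sum_(i < M) w x i.+1 * star_sum i.+1 k' else 1.

(* The part of the star sum in which [m_1 = i.+1]. *)
Definition star_head (k : seq nat) (i : nat) : A :=
  if k is x :: k' then w x i.+1 * star_sum i.+1 k' else 0.

Lemma star_sum_head k M : k != [::] -> star_sum M k = \sum_(i < M) star_head k i.
Proof. by case: k. Qed.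

Lemma big_cons_tuple (T : finType) n (P : pred (seq T)) (F : seq T -> A) :
  \sum_(t : n.+1.-tuple T | P t) F t =
  \sum_(x : T) \sum_(t : n.-tuple T | P (x :: t)) F (x :: t).
Proof.
rewrite pair_big_dep /=.
rewrite (reindex (fun u : T * n.-tuple T => cons_tuple u.1 u.2)) //=.
exists (fun t => (thead t, behead_tuple t)) => [[x t] _|t _] /=.
  by congr (_, _); apply: val_inj.
by rewrite [t in RHS]tuple_eta; apply: val_inj.
Qed.

(** For the induction on [k] the bound [b] must shrink to the outermost variable while the type of
    the ordinals stays fixed. *)
Lemma star_sum_path L b k : (b <= L)%N ->
  \sum_(m : (size k).-tuple 'I_L.+1 |
      path geq b [seq val i | i <- m] && all (leq 1) [seq val i | i <- m])
    \prod_(a < size k) w (nth 0 k a) (nth 0 [seq val i | i <- m] a) =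
  star_sum b k.
Proof.
elim: k b => [|x k IH] b bL /=.
  rewrite (big_pred1 [tuple]) ?big_ord0 // => t.
  by rewrite tuple0 /= eqxx.
rewrite (big_cons_tuple _ (fun s => path geq b [seq val i | i <- s] &&
    all (leq 1) [seq val i | i <- s]) (fun s => \prod_(a < (size k).+1)
    w (nth 0 (x :: k) a) (nth 0 [seq val i | i <- s] a))).
(* Positivity excludes the ordinal 0, hence the shift to [i.+1]. *)
rewrite big_ord_recl [X in X + _]big_pred0 ?add0r => [|t]; last by rewrite /= andbF.
rewrite [RHS](big_ord_widen _ (fun i => w x i.+1 * star_sum i.+1 k) bL).
rewrite [RHS]big_mkcond /=; apply: eq_bigr => i _.
case: ifPn => ib; last first.
  by rewrite big_pred0 // => t; rewrite /= lift0 /= ib.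
rewrite -IH // mulr_sumr; apply: eq_big => [t|t _] //.
by rewrite big_ord_recl.
Qed.

Lemma star_sumE M k :
  \sum_(m : (size k).-tuple 'I_M.+1 | star_chain m)
    \prod_(a < size k) w (nth 0 k a) (tnth m a) = star_sum M k.
Proof.
rewrite -(star_sum_path k (leqnn M)); apply: eq_big => [m|m _].
  rewrite /star_chain; congr (_ && _).
  case: (tval m) => //= y s; suff -> : (y <= M)%N by [].
  by rewrite -ltnS.
apply: eq_bigr => a _; congr (w _ _).
by rewrite (nth_map (tnth m a)) ?size_tuple // -tnth_nth.
Qed.

End StarSums.

Lemma HstarE (A : comUnitRingType) (q : A) M k :
  Hstar q M k = star_sum (fun x m => q ^+ (x.-1 * m) / qint q m ^+ x) M k.
Proof. by rewrite -star_sumE. Qed.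

Lemma HbarstarE (A : comUnitRingType) (q : A) M k :
  Hbarstar q M k = star_sum (fun x m => q ^+ m / qint q m ^+ x) M k.
Proof. by rewrite -star_sumE. Qed.

(** * Hoffman's dual under the two ways of lengthening an index *)

Lemma index_ind (P : seq nat -> Prop) :
  P [:: 1%N] ->
  (forall x k, P (x.+1 :: k) -> P (x.+2 :: k)) ->
  (forall k, is_index k -> P k -> P (1%N :: k)) ->
  forall k, is_index k -> P k.
Proof.
move=> P1 Pplus Pcomma; elim=> // -[|x] k IH //= /andP[_ /= k1].
elim: x => [|x IHx]; last exact: Pplus.
have [->|k0] := eqVneq k [::]; first exact: P1.
have hk : is_index k by rewrite /is_index k0.
by apply: Pcomma => //; apply: IH.
Qed.

(** The accumulator reaches only the first component. Hence a leading comma, negated to a plus sign,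
    just raises the first component of the dual. *)
Lemma of_separators_shape s :
  exists a r, forall n, of_separators n s = (a + n)%N :: r.
Proof.
elim: s => [|[] s [a [r IH]]]; first by exists 0%N, [::].
  by exists 0%N, (of_separators 1 s).
by exists a.+1, r => n /=; rewrite IH addSnnS.
Qed.

Lemma hoffman_dual_neq0 k : hoffman_dual k != [::].
Proof.
rewrite /hoffman_dual; set s := map _ _.
by have [a [r ->]] := of_separators_shape s.
Qed.

Lemma hoffman_dual_plus x k :
  hoffman_dual (x.+2 :: k) = 1%N :: hoffman_dual (x.+1 :: k).
Proof. by []. Qed.

Lemma hoffman_dual_comma k : is_index k ->
  exists x r, hoffman_dual k = x :: r /\ hoffman_dual (1%N :: k) = x.+1 :: r.
Proof.
case: k => // y k _; rewrite /hoffman_dual /separators /=.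
set s := map negb _; case: (of_separators_shape s) => a [r e].
by exists (a + 1)%N, r; split; rewrite e // (addnS a 1).
Qed.

(** Split off the terms whose largest variable is [M+1]. For [l > 0], stripping that variable leaves
    [l-1] ones at the same bound [M+1], so [E M.+1] reappears; the excess top term is killed by
    [x^(K+1) = 0]. *)
Lemma star_sum_geom (A : comNzRingType) (w : nat -> nat -> A) x K k M :
  x ^+ K.+1 = 0 -> k != [::] ->
  let E M := \sum_(l < K.+1) x ^+ l * star_sum w M (nseq l 1%N ++ k) in
  (1 - x * w 1%N M.+1) * E M.+1 = E M + star_head w k M.
Proof.
move=> xK k0 E.
have kl l : nseq l 1%N ++ k != [::] by case: l.
have -> : E M = E M.+1 -
    \sum_(l < K.+1) x ^+ l * star_head w (nseq l 1%N ++ k) M.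
  rewrite /E -sumrB; apply: eq_bigr => l _.
  by rewrite !star_sum_head // big_ord_recr /= mulrDr addrK.
rewrite mulrBl mul1r big_ord_recl expr0 mul1r /=.
have -> : x * w 1%N M.+1 * E M.+1 =
   \sum_(l < K) x ^+ (lift ord0 l) * star_head w (nseq (lift ord0 l) 1%N ++ k) M.
  rewrite mulr_sumr big_ord_recr /= [X in _ + X](_ : _ = 0) ?addr0.
    by apply: eq_bigr => l _; rewrite /bump /= add1n exprS; ring.
  transitivity (x ^+ K.+1 * (w 1%N M.+1 * star_sum w M.+1 (nseq K 1%N ++ k))).
    by rewrite exprS; ring.
  by rewrite xK mul0r.
by ring.
Qed.

(** * Duality of star sums with a prescribed largest variable *)

Section Duality.
Context {A : comUnitRingType}.
Variables (q : A) (N : nat).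
Hypothesis unit_qint : forall j, (j < N)%N -> qint q j.+1 \is a GRing.unit.

Let w x m := q ^+ (x.-1 * m) / qint q m ^+ x.
Let wbar x m := q ^+ m / qint q m ^+ x.

Lemma star_head_bar_plus x r i : (i < N)%N ->
  star_head wbar (x :: r) i = qint q i.+1 * star_head wbar (x.+1 :: r) i.
Proof.
move=> iN; rewrite /= /wbar (exprS _ x) invrM ?unitrX ?unit_qint //.
transitivity (q ^+ i.+1 / qint q i.+1 ^+ x * (qint q i.+1 / qint q i.+1) *
  star_sum wbar i.+1 r); first by rewrite divrr ?unit_qint // mulr1.
by ring.
Qed.

Lemma star_head_dual k : is_index k -> forall i, (i < N)%N ->
  star_head wbar (hoffman_dual k) i = btrans q (star_head w k) i.
Proof.
move: k; apply: index_ind => [|x k IH|k hk IH] i iN;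
  have Ui := unit_qint iN; apply: (mulrI Ui).
(* All partial sums of (1, 0, 0, ...) are 1, so [1/[j+1]] is its average. *)
- rewrite (btrans_average (a := fun j => (j == 0)%:R)) => [|j ji].
    by rewrite btrans_delta /= /wbar expr1 mulr1 mulrC divrK.
  rewrite /= /w mul0n expr0 expr1 mul1r mulr1.
  rewrite divrr ?unit_qint ?(leq_ltn_trans ji) //.
  by rewrite big_ord_recl big1 ?addr0.
(* A plus sign in [k] is a comma in the dual: a factor [q^(j+1)/[j+1]] becomes an averaging. *)
- rewrite (btrans_mul (a := star_head w (x.+1 :: k))) => [|j ji]; last first.
    have U := unit_qint (leq_ltn_trans ji iN).
    rewrite /= /w /= mulSn exprD (exprS _ x.+1) invrM ?unitrX //.
    transitivity (q ^+ j.+1 * (q ^+ (x * j.+1) / qint q j.+1 ^+ x.+1 *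
        star_sum w j.+1 k) * (qint q j.+1 / qint q j.+1)); first by ring.
    by rewrite divrr // mulr1.
  rewrite hoffman_dual_plus /= /wbar expr1 mulrA mulrCA divrr // mulr1.
  congr (_ * _); rewrite star_sum_head ?hoffman_dual_neq0 //.
  by apply: eq_bigr => j _; rewrite IH // (leq_ltn_trans _ iN) // -ltnS.
(* A comma in [k] is a plus sign in the dual: an averaging becomes division by [[i+1]]. *)
- have [x [r [e1 e2]]] := hoffman_dual_comma hk.
  rewrite e2 -star_head_bar_plus // -e1 IH //.
  rewrite -(btrans_average (h := star_head w (1%N :: k))) // => j ji.
  rewrite /= /w mul0n expr0 expr1 mul1r mulVKr ?unit_qint ?(leq_ltn_trans ji) //.
  by rewrite star_sum_head //; case/andP: hk.
Qed.

End Duality.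

(** * Weighted sums over a finite range, with [N+1] in the role of the prime *)

Section Truncated.
Context {A : comUnitRingType}.
Variables (q : A) (N : nat).
Hypothesis unit_q : q \is a GRing.unit.
Hypothesis unit_qint : forall j, (j < N)%N -> qint q j.+1 \is a GRing.unit.

Let w x m := q ^+ (x.-1 * m) / qint q m ^+ x.
Let wbar x m := q ^+ m / qint q m ^+ x.
(** The inverse coefficient from [qbin_orthogonal] times [q^(N-n)]; with the [q^(n+1)] inside
    [btrans] this factor makes the constant [q^(N+1)]. *)
Definition bar_coef n : A := (-1) ^+ (N - n) * q ^+ 'C((N - n).+1, 2) * qbin q N n.

Lemma qint_split M : (M < N)%N ->
  qint q N.+1 = qint q M.+1 + q ^+ M.+1 * qint q (N - M).
Proof. by move=> MN; rewrite -qintD addSn subnKC // ltnW. Qed.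

Lemma btrans_coef_step M : (M < N)%N ->
  btrans_coef q N M * (1 - qint q N.+1 * w 1%N M.+1) = btrans_coef q N M.+1.
Proof.
move=> MN; apply: (mulrI (unit_qint MN)).
rewrite /w mul0n expr0 expr1 mul1r.
transitivity (btrans_coef q N M *
   (qint q M.+1 - qint q N.+1 * (qint q M.+1 / qint q M.+1))); first by ring.
rewrite divrr ?unit_qint // mulr1 (qint_split MN) /btrans_coef.
transitivity ((-1) ^+ M.+1 * (q ^+ 'C(M.+1, 2) * q ^+ M.+1) *
   (qint q (N - M) * qbin q N M)); first by rewrite !exprS; ring.
by rewrite -qint_qbin_right (binS M.+1) bin1 !exprD !exprS; ring.
Qed.

(** After clearing denominators this rests on [q^(N+1) [M+1] - q^(M+1) [N+1] = - q^(M+1) [N-M]],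
    which is why the dual series carries an inverse power of [q]. *)
Lemma bar_coef_step M : (M < N)%N ->
  bar_coef M * (1 - (q ^+ N.+1)^-1 * qint q N.+1 * wbar 1%N M.+1) = bar_coef M.+1.
Proof.
move=> MN; have Uq : q ^+ N.+1 \is a GRing.unit by rewrite unitrX.
apply: (mulrI Uq); apply: (mulrI (unit_qint MN)); rewrite /wbar expr1.
transitivity (bar_coef M * (q ^+ N.+1 * qint q M.+1 - qint q N.+1 * q ^+ M.+1 *
   ((q ^+ N.+1 / q ^+ N.+1) * (qint q M.+1 / qint q M.+1)))).
  by move: (q ^+ N.+1) (q ^+ M.+1) => Q R; ring.
rewrite !divrr ?unit_qint // !mulr1.
have e1 : qint q N.+1 = qint q (N - M) + q ^+ (N - M) * qint q M.+1.
  by rewrite -qintD addnS subnK // ltnW.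
have e2 : q ^+ N.+1 = q ^+ (N - M) * q ^+ M.+1.
  by rewrite -exprD addnS subnK // ltnW.
have e3 : (N - M)%N = (N - M.+1).+1 by rewrite subnSK.
rewrite e1 /bar_coef.
transitivity (- ((-1) ^+ (N - M) * q ^+ 'C((N - M).+1, 2) * q ^+ M.+1 *
  (qint q (N - M) * qbin q N M))); first by rewrite e2; ring.
rewrite -qint_qbin_right (binS (N - M)) bin1 exprD e2.
by rewrite {1}e3 exprS -e3; ring.
Qed.

(** The recursion for [d] is the integrating factor of [star_sum_geom]: [d M] times the generating
    sum at [M] telescopes. *)
Lemma sum_star_head (d : nat -> A) v x K k : x ^+ K.+1 = 0 -> k != [::] ->
  (forall M, (M < N)%N -> d M * (1 - x * v 1%N M.+1) = d M.+1) ->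
  \sum_(m < N) d m * star_head v k m =
  d N * \sum_(l < K.+1) x ^+ l * star_sum v N (nseq l 1%N ++ k).
Proof.
move=> xK k0 dS.
suff : forall M, (M <= N)%N -> \sum_(m < M) d m * star_head v k m =
    d M * \sum_(l < K.+1) x ^+ l * star_sum v M (nseq l 1%N ++ k) by exact.
elim=> [|M IH] MN.
  rewrite big_ord0 big1 ?mulr0 // => l _.
  by rewrite star_sum_head ?big_ord0 ?mulr0 //; case: (val l).
rewrite big_ord_recr /= IH ?(ltnW MN) // -mulrDr -(star_sum_geom _ _ xK k0).
by rewrite mulrA dS.
Qed.

(* Extending [f] by [0] at index [N], the transform at [N] is the first sum up to
   a power of [q]; inverting the transform at [N] must give back [0]. *)
Lemma btrans_truncated_inversion (f g : nat -> A) :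
  (forall i, (i < N)%N -> g i = btrans q f i) ->
  q ^+ N.+1 * \sum_(m < N) btrans_coef q N m * f m +
  \sum_(n < N) bar_coef n * g n = 0.
Proof.
move=> gf; pose s m := (-1) ^+ m * q ^+ 'C(m.+1, 2) * f m.
pose c r := (-1) ^+ r * q ^+ 'C(r, 2) : A.
have -> : \sum_(n < N) bar_coef n * g n = q ^+ N.+1 *
    \sum_(m < N) s m * \sum_(n < N) c (N - n)%N * (qbin q N n * qbin q n m).
  under [X in _ = _ * X]eq_bigr => m _ do rewrite mulr_sumr.
  rewrite exchange_big mulr_sumr; apply: eq_bigr => n _ /=; rewrite gf // /btrans.
  rewrite (big_ord_widen N (fun j => btrans_coef q n j * f j)) // big_mkcond /=.
  rewrite !mulr_sumr; apply: eq_bigr => m _; case: ltnP => mn; last first.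
    by rewrite [qbin q n m]qbin_small // !mulr0.
  have e : q ^+ N.+1 = q ^+ (N - n) * q ^+ n.+1.
    by rewrite -exprD addnS subnK // ltnW.
  rewrite e /bar_coef /btrans_coef /s /c (binS (N - n)) bin1 exprD.
  by ring.
rewrite -mulrDr -big_split big1 /= => [|m _]; first by rewrite mulr0.
(* The first sum supplies the missing term [n = N] of the orthogonality relation, whose value is 0
   because [m < N]. *)
have := qbin_orthogonal q N m; rewrite gtn_eqF // big_ord_recr /=.
rewrite subnn bin_small // !expr0 !mul1r qbinn mul1r => /eqP.
rewrite addr_eq0 => /eqP ->.
by rewrite /btrans_coef /s; ring.
Qed.

Lemma truncated_duality K k : ~~ odd N -> qint q N.+1 ^+ K.+1 = 0 -> is_index k ->
  q ^+ (N.+1 * N.+2)./2 *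
    \sum_(l < K.+1) qint q N.+1 ^+ l * Hstar q N (nseq l 1%N ++ k) +
  \sum_(l < K.+1) ((q ^+ N.+1)^-1 * qint q N.+1) ^+ l *
    Hbarstar q N (nseq l 1%N ++ hoffman_dual k) = 0.
Proof.
move=> oN pK hk.
have pK' : ((q ^+ N.+1)^-1 * qint q N.+1) ^+ K.+1 = 0 by rewrite exprMn pK mulr0.
have k0 : k != [::] by case/andP: hk.
under eq_bigr => l _ do rewrite HstarE.
under [X in _ + X]eq_bigr => l _ do rewrite HbarstarE.
have := btrans_truncated_inversion (star_head_dual unit_qint hk).
rewrite (sum_star_head pK k0 btrans_coef_step).
rewrite (sum_star_head pK' (hoffman_dual_neq0 k) bar_coef_step) mulrA.
rewrite /bar_coef subnn bin_small // !expr0 qbinn !mul1r.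
(* Evenness of [N] removes the sign [(-1)^N]; the exponents [N+1] and [C(N+1, 2)] add up to
   [C(N+2, 2)]. *)
rewrite /btrans_coef qbinn mulr1 -signr_odd (negbTE oN) expr0 mul1r -exprD.
by rewrite mulnC -(bin2 N.+2) (binS N.+1) bin1 addnC.
Qed.

End Truncated.

(** * Passage from single primes to the inverse limit *)

Lemma Zprod_sumE n (I : finType) (F : I -> Zprod n) p :
  (\sum_i F i) p = \sum_i F i p.
Proof. by elim/big_rec2: _ => // i x y _ <-. Qed.

Lemma Zprod_exprE n (f : Zprod n) l p : (f ^+ l) p = f p ^+ l.
Proof. by elim: l => // l IHl; rewrite !exprS dprodM IHl. Qed.

Lemma limn_adic_series (a : Qhat) (u : nat -> Qhat) :
  limn (series (fun l => (a * bold_p) ^+ l * u l)) =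
  adic_sum (fun l => a ^+ l * u l).
Proof.
apply: cvg_lim; first exact: Qhat_hausdorff.
rewrite (_ : (fun l => (a * bold_p) ^+ l * u l) =
  fun l => bold_p ^+ l * (a ^+ l * u l)); first exact: cvg_adic_sum.
by apply/funext => l; rewrite [a * _]mulrC exprMn mulrA.
Qed.

(** Level [n] is the quotient by [[p]^(n+1)], so only the terms with [l <= n] survive. *)
Lemma Qhat_proj_adic_sum n (a : Qhat) (u : nat -> Qhat) :
  Qhat_proj n (adic_sum (fun l => a ^+ l * u l)) =
  \sum_(l < n.+1) (Qhat_proj n a * Qhat_proj n bold_p) ^+ l * Qhat_proj n (u l).
Proof.
transitivity (Qhat_proj n (\sum_(l < n.+1) bold_p ^+ l * (a ^+ l * u l))) => //.
rewrite rmorph_sum; apply: eq_bigr => l _.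
by rewrite mulrA mulrC mulrA !rmorphM !rmorphXn /= exprMn; ring.
Qed.

Theorem theorem5p4 (k : seq nat) (hk : is_index k) :
  q_triangle_p
    * limn (series (fun l : nat => bold_p ^+ l * zeta_star (nseq l 1%N ++ k)))
  + limn (series (fun l : nat =>
      (q_opp_p * bold_p) ^+ l * zeta_barstar (nseq l 1%N ++ hoffman_dual k)))
  = 0.
Proof.
have -> : (fun l => bold_p ^+ l * zeta_star (nseq l 1%N ++ k)) =
    fun l => (1 * bold_p) ^+ l * zeta_star (nseq l 1%N ++ k) by rewrite mul1r.
rewrite !limn_adic_series; apply: Qhat_eq => n.
rewrite rmorphD rmorphM /= !Qhat_proj_adic_sum rmorph1 mul1r rmorph0.
(* Explicit representatives in the product over all primes, so that the identity can be tested prime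
   by prime. *)
pose t : Zprod n := fun p => qvar ^+ (p * p.+1)./2.
pose b : Zprod n := fun p => qint qvar p.
pose o : Zprod n := fun p => (qvar ^+ p)^-1.
pose z l : Zprod n := fun p => Hstar qvar p.-1 (nseq l 1%N ++ k).
pose zb l : Zprod n := fun p => Hbarstar qvar p.-1 (nseq l 1%N ++ hoffman_dual k).
transitivity (Qn_pi (t * (\sum_(l < n.+1) b ^+ l * z l) +
                     \sum_(l < n.+1) (o * b) ^+ l * zb l)).
  rewrite rmorphD rmorphM !rmorph_sum /=; congr (_ * _ + _).
    by apply: eq_bigr => l _; rewrite rmorphM rmorphXn.
  by apply: eq_bigr => l _; rewrite rmorphM rmorphXn rmorphM.
rewrite -(rmorph0 (@Qn_pi n)); apply/Qn_pi_eq.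
(* Finitely many primes may be discarded; 2 is the one for which [p - 1] is odd. *)
apply: sub_finite_set (finite_set1 (PrimeNat (isT : prime 2))) => p /=.
apply: contraNP => p2; apply/eqP.
rewrite dprodD dprodM !Zprod_sumE.
under eq_bigr => l _ do rewrite dprodM Zprod_exprE.
under [X in _ + X]eq_bigr => l _ do rewrite dprodM Zprod_exprE dprodM.
have [N pN] : exists N, p = N.+1 :> nat.
  by exists p.-1; rewrite prednK // prime_gt0 // prime_valP.
have oN : ~~ odd N.
  have /even_prime[p2'|] : prime p := prime_valP p; last by rewrite pN.
  by case: p2; apply: val_inj.
have U j : (j < N)%N -> qint (qvar : Zpn p n) j.+1 \is a GRing.unit.
  by move=> jN; rewrite unit_qint // pN.
have Uq : (qvar : Zpn p n) \is a GRing.unit.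
  by have := unit_qvar_exp_prime p n; rewrite unitrX_pos // prime_gt0 // prime_valP.
have := truncated_duality Uq U oN _ hk (K := n).
have pN1 : p.-1 = N by rewrite pN.
by rewrite /t /b /z /zb /o pN1 -pN; apply; rewrite qint_prime_expr0.
Qed.
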